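(* Assume $X[\mathcal{T}]$ is a locally convex topological vector space and $\mathcal{C}$ is a localizing family in $X$. Then there exists a unique localization of $\mathcal{T}$ by $\mathcal{C}$, and it is given by the formula $$\mathcal{S}=\{E\subseteq X:\text{ for every }x\in E\text{ there is a convex set }V\subseteq X\text{ such that }x\in V\subseteq E\text{ and }V\cap C\in\mathcal{T}|_C\text{ for all }C\in\mathcal{C}\}.$$
   Context: All vector spaces are real. A vector topology is a topology for which singletons are closed (hence it is Hausdorff) and addition and scalar multiplication are continuous; $X[\mathcal{T}]$ denotes $X$ equipped with $\mathcal{T}$. For a collection $\mathcal{T}$ of subsets of $X$ and $C\subseteq X$, $\mathcal{T}|_C=\{E\cap C:E\in\mathcal{T}\}$. A localizing family in a vector space $X$ is a collection $\mathcal{C}$ of subsets of $X$ such that: (i) $\mathcal{C}$ is non-empty; (ii) each member of $\mathcal{C}$ is convex and contains $0$; (iii) for every $C\in\mathcal{C}$, $x\in X$, $t\in\mathbb{R}$ there is $D\in\mathcal{C}$ with $x+t\cdot C\subseteq D$. Given a locally convex topological vector space $X[\mathcal{T}]$ and a localizing family $\mathcal{C}$ in $X$, a localization of $\mathcal{T}$ by $\mathcal{C}$ is a locally convex vector topology $\mathcal{S}$ on $X$ such that: (i) for every $C\in\mathcal{C}$, $\mathcal{S}|_C\subseteq\mathcal{T}|_C$; (ii) for every locally convex topological vector space $Y[\mathcal{U}]$ and every linear map $f:X\to Y$, if the restriction $f|_C:C\to Y$ is $(\mathcal{T}|_C,\mathcal{U})$-continuous for every $C\in\mathcal{C}$, then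 $f$ is $(\mathcal{S},\mathcal{U})$-continuous. *)

(* Defs.v *)
From HB Require Import structures.
From mathcomp Require Import all_boot all_order all_algebra.
From mathcomp Require Import all_classical all_reals all_analysis.

Set Implicit Arguments.
Unset Strict Implicit.
Unset Printing Implicit Defensive.

Import Order.TTheory GRing.Theory Num.Theory.
Import numFieldNormedType.Exports.
Local Open Scope classical_set_scope.
Local Open Scope ring_scope.

(* Topologies as collections of subsets.  The empty set is open by taking the
   union of the empty collection. *)
Definition is_topology (X : Type) (S : set_system X) : Prop :=
  [/\ S [set: X], setI_closed S &
      forall F : set_system X, F `<=` S -> S (\bigcup_(E in F) E)].

(* The type X equipped with S, so that a topology S other than the canonical
   one of X can be fed to the library's topological notions. *)
Definition topologized (X : Type) (S : set_system X) (hS : is_topology S) :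
  Type := X.

Section Topologized.
Variables (X : choiceType) (S : set_system X) (hS : is_topology S).

Let opT : S [set: X]. Proof. by case: hS. Qed.

Let opI : setI_closed S. Proof. by case: hS. Qed.

Let op_bigU (I : Type) (f : I -> set X) :
  (forall i, S (f i)) -> S (\bigcup_i f i).
Proof.
move=> Sf; case: hS => _ _ /(_ (range f)); rewrite bigcup_image; apply.
by move=> _ [i _ <-].
Qed.

HB.instance Definition _ := Choice.on (topologized hS).
HB.instance Definition _ :=
  isOpenTopological.Build (topologized hS) opT opI op_bigU.

Lemma open_topologized : @open (topologized hS) = S.
Proof. by []. Qed.

End Topologized.

HB.instance Definition _ (R : numDomainType) (X : lmodType R)
    (S : set_system X) (hS : is_topology S) :=
  GRing.Lmodule.on (topologized hS).

(* The last three clauses are the fields of PreTopologicalLmod_isTvs: they say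
   that topologized hS can be made a tvsType.  In the library, tvsType includes
   local convexity but no separation axiom, so closedness of singletons is
   always required separately. *)
Definition is_lc_vector_topology (R : realType) (X : lmodType R)
    (S : set_system X) : Prop :=
  exists hS : is_topology S, let XS := topologized hS in
  [/\ forall x : XS, closed [set x],
      continuous (fun z : XS * XS => z.1 + z.2),
      continuous (fun z : R^o * XS => z.1 *: z.2) &
      exists2 B : set_system XS, (forall b, b \in B -> convex_set b) & basis B].

Definition trace (X : Type) (T : set_system X) (C : set X) : set_system X :=
  [set E `&` C | E in T].

Definition localizing_family (R : realType) (X : lmodType R)
    (CC : set_system X) : Prop :=
  [/\ CC !=set0,
      forall C, CC C -> convex_set C /\ C 0 &
      forall C (x : X) (t : R), CC C ->
        exists2 D, CC D & [set x + t *: y | y in C] `<=` D].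

(* S is a localization by CC of the canonical topology of X. *)
Definition is_localization (R : realType) (X : tvsType R)
    (CC S : set_system X) : Prop :=
  [/\ is_lc_vector_topology S,
      forall C, CC C -> trace S C `<=` trace open C &
      forall (Y : tvsType R) (f : {linear X -> Y}),
        (forall y : Y, closed [set y]) ->
        (forall C, CC C -> {within C, continuous f}) ->
        forall U, open U -> S (f @^-1` U)].

(* Main.v *)
Require Import Defs.
From HB Require Import structures.
From mathcomp Require Import all_boot all_order all_algebra.
From mathcomp Require Import all_classical all_reals all_analysis.
From mathcomp Require Import ring lra.

Import Order.TTheory GRing.Theory Num.Theory.
Import numFieldNormedType.Exports.
Local Open Scope classical_set_scope.
Local Open Scope ring_scope.

(* Call a convex set good if its trace on each C in CC is relatively open in C.
   Since CC is stable under affine maps y |-> x + t y up to enlarging its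
   members, preimages of good sets under such maps are good.  Hence the good
   sets are a base of a topology that is continuous for the vector operations:
   if V is good and contains a + b, the sets of y with b - a + 2 y in V and of
   z with a - b + 2 z in V are good neighbourhoods of a and b, and midpoints
   show that their sum lies in V; for scaling one also needs that good
   neighbourhoods of 0 absorb x, because some member of CC contains the segment
   from -x to x.  The universal property pulls back convex open sets of Y.
   Conversely, a convex open set of any localization is good, and the universal
   property applied to the identity gives the other inclusion. *)

Lemma convex_setE (R : realType) (X : lmodType R) (A : set X) :
  convex_set A <->
  forall x y (t : R), A x -> A y -> 0 <= t -> t <= 1 ->
    A (t *: x + (1 - t) *: y).
Proof.
split=> [cA x y t Ax Ay t0 t1|cA x y l].
  have t01 : Itv.spec (@Itv.num_sem R) (Itv.Real `[0%Z, 1%Z]) t.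
    by rewrite /Itv.num_sem /= in_itv /= t0 t1 andbT ger0_real.
  by have /set_mem := cA x y (Itv.mk t01) (mem_set Ax) (mem_set Ay).
move=> /set_mem Ax /set_mem Ay; apply/mem_set.
exact: (cA x y l%:num Ax Ay).
Qed.

Section ConvexSets.
Variables (R : realType) (X : lmodType R).

Lemma convex_set_half (A : set X) x y : convex_set A ->
  A (2 *: x) -> A (2 *: y) -> A (x + y).
Proof.
move=> /convex_setE cA Ax Ay.
have := cA _ _ 2^-1 Ax Ay ltac:(lra) ltac:(lra).
rewrite !scalerA; have -> : 2^-1 * 2 = 1 :> R by lra.
have -> : (1 - 2^-1) * 2 = 1 :> R by lra.
by rewrite !scale1r.
Qed.

Lemma convex_set_symm (A : set X) (r s : R) x : convex_set A ->
  0 < r -> `|s| <= r -> A (r *: x) -> A (- r *: x) -> A (s *: x).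
Proof.
move=> /convex_setE cA r0; rewrite ler_norml => /andP[rs sr] Ax Ay.
(* The weight [l] is the solution of [s = l * r + (1 - l) * - r]. *)
have ge0 : 0 <= (r + s) / (2 * r) by apply: divr_ge0; lra.
have le1 : (r + s) / (2 * r) <= 1 by rewrite ler_pdivrMr; lra.
have := cA _ _ _ Ax Ay ge0 le1.
rewrite !scalerA -scalerDl; congr (A (_ *: x)).
by field; lra.
Qed.

Lemma convex_setI (A B : set X) :
  convex_set A -> convex_set B -> convex_set (A `&` B).
Proof.
move=> /convex_setE cA /convex_setE cB; apply/convex_setE.
by move=> x y t [Ax Bx] [Ay By] t0 t1; split; [exact: cA|exact: cB].
Qed.

Lemma convex_set_preimage_affine (A : set X) x (t : R) :
  convex_set A -> convex_set [set y | A (x + t *: y)].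
Proof.
move=> /convex_setE cA; apply/convex_setE => y z s /= Ay Az s0 s1.
have := cA _ _ s Ay Az s0 s1; congr A.
rewrite !scalerDr !scalerA [t * s]mulrC [t * (1 - s)]mulrC addrACA -scalerDl.
have -> : s + (1 - s) = 1 by ring.
by rewrite scale1r.
Qed.

Lemma convex_set_preimage_linear (Y : lmodType R) (f : {linear X -> Y})
    (B : set Y) : convex_set B -> convex_set (f @^-1` B).
Proof.
move=> /convex_setE cB; apply/convex_setE => x y t /= Bx By t0 t1.
by rewrite linearD !linearZ; exact: cB.
Qed.

End ConvexSets.

(** * The candidate topology and its universal property *)

Section Localization.
Variables (R : realType) (X : tvsType R).
Implicit Types (CC S : set_system X) (V : set X) (x y : X) (t : R).

Lemma open_convex_nbhs (Y : tvsType R) (U : set Y) (y : Y) : open U -> U y ->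
  exists V : set Y, [/\ convex_set V, open V, V y & V `<=` U].
Proof.
have [B cB [oB bB]] := @locally_convex R Y.
move=> oU Uy; have [|V [BV Vy] VU] := bB y U; first exact: open_nbhs_nbhs.
by exists V; split=> //; [apply: cB; exact: mem_set|exact: oB].
Qed.

(** The universal property ranges over bundled spaces, so [S] must first become the topology of one.
    The map [f] is the identity of [X]; all that is kept of it is that [S] is the topology it
    induces from [Y]. *)
Lemma lc_vector_topology_tvs S : is_lc_vector_topology S ->
  exists (Y : tvsType R) (f : {linear X -> Y}),
    (forall y : Y, closed [set y]) /\ S = [set f @^-1` U | U in open].
Proof.
move=> [hS [S1 Sadd Sscale Slc]].
(* PreTopologicalLmod_isTvs only provides the uniform structure, so the other
   mixins of tvsType have to be added separately. *)
pose addM :=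
  PreTopologicalNmodule_isTopologicalNmodule.Build (topologized hS) Sadd.
pose scaleM :=
  TopologicalNmodule_isTopologicalLmodule.Build R (topologized hS) Sscale.
pose unifM :=
  PreTopologicalLmod_isTvs.Build R (topologized hS) Sadd Sscale Slc.
pose YU : PreUniformLmodule.type R := HB.pack (topologized hS) unifM.
pose lcM := Uniform_isTvs.Build R YU Slc.
pose Y : tvsType R := HB.pack (topologized hS) addM scaleM unifM lcM.
have lin : linear (fun x : X => x : Y) by [].
pose fL := GRing.isLinear.Build R X Y _ _ lin.
pose f : {linear X -> Y} := HB.pack (fun x : X => x : Y) fL.
exists Y, f; split; first exact: S1.
apply/seteqP; split=> [E SE|_ [U oU <-]]; last exact: oU.
by exists E.
Qed.

(** The convex sets with this property are the good sets. *)
Definition relatively_open CC V := forall C, CC C -> trace open C (V `&` C).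

Definition localization CC : set_system X :=
  [set E | forall x, E x -> exists V,
    [/\ convex_set V, V x, V `<=` E & relatively_open CC V]].

Lemma open_relatively_open CC V : open V -> relatively_open CC V.
Proof. by move=> oV C _; exists V. Qed.

Lemma localization_convex CC V :
  convex_set V -> relatively_open CC V -> localization CC V.
Proof. by move=> cV oV x Vx; exists V; split. Qed.

Lemma relatively_openI CC V W : relatively_open CC V ->
  relatively_open CC W -> relatively_open CC (V `&` W).
Proof.
move=> oV oW C CCC; have [G oG GV] := oV C CCC.
have [H oH HW] := oW C CCC.
exists (G `&` H); first exact: openI.
by rewrite !(setIIl _ _ C) GV HW.
Qed.

Lemma within_continuous_trace (Y : topologicalType) (f : X -> Y) (C : set X) :
  {within C, continuous f} <->
  forall U, open U -> trace open C (f @^-1` U `&` C).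
Proof.
split=> [/continuousP h U oU|h]; last apply/continuousP => U oU.
  have /open_subspaceP[V oV VC] := h U oU.
  by exists V.
have [V oV VC] := h U oU; apply/open_subspaceP.
by exists V.
Qed.

Lemma localization_is_topology CC : is_topology (localization CC).
Proof.
split=> [x _|E F SE SF x [Ex Fx]|F FS x [E FE Ex]].
- exists setT; split=> //; last by apply: open_relatively_open; exact: openT.
- have [V [cV Vx VE oV]] := SE x Ex; have [W [cW Wx WF oW]] := SF x Fx.
  exists (V `&` W); split=> //; first exact: convex_setI.
    exact: setISS.
  exact: relatively_openI.
- have [V [cV Vx VE oV]] := FS E FE x Ex.
  by exists V; split=> // y /VE Ey; exists E.
Qed.

Lemma localization_trace CC C :
  CC C -> trace (localization CC) C `<=` trace open C.
Proof.
move=> CCC _ [E SE <-].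
(* Each point of [E] in [C] comes with its own open set; the union of all open sets whose trace on
   [C] lies in [E] serves every point at once. *)
exists (\bigcup_(G in [set G | open G /\ G `&` C `<=` E]) G).
  by apply: bigcup_open => G [].
apply/seteqP; split=> x /=.
  by move=> [[G [_ GE] Gx] Cx]; split=> //; exact: GE.
move=> [Ex Cx]; split=> //; have [V [_ Vx VE /(_ C CCC)[G oG GV]]] := SE x Ex.
have : (V `&` C) x by [].
rewrite -GV => -[Gx _]; exists G => //; split=> //.
by rewrite GV => y [/VE].
Qed.

Lemma localization_preimage_open CC (Y : tvsType R) (f : {linear X -> Y}) :
  (forall C, CC C -> {within C, continuous f}) ->
  forall U, open U -> localization CC (f @^-1` U).
Proof.
move=> cf U oU x Ux; have [B [cB oB Bx BU]] := open_convex_nbhs _ _ _ oU Ux.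
exists (f @^-1` B); split=> //.
- exact: convex_set_preimage_linear.
- by move=> y /BU.
- by move=> C /cf/within_continuous_trace; apply.
Qed.

(** * Affine stability and continuity of the vector operations *)

Section LocalizingFamily.
Variables (CC : set_system X) (hCC : localizing_family CC).

Lemma relatively_open_preimage_affine V x t :
  relatively_open CC V -> relatively_open CC [set y | V (x + t *: y)].
Proof.
(* The affine map sends [C] into [D], so an open [G] that agrees with [V] on [D] pulls back to an
   open set that agrees with the preimage of [V] on [C]. *)
case: hCC => _ _ hD oV C CCC; have [D CCD CD] := hD C x t CCC.
have [G oG GV] := oV D CCD; exists [set y | G (x + t *: y)].
  apply: (open_comp (f := fun y => x + t *: y)) oG => y _.
  apply: (@continuous_comp _ _ _ (fun y => (x, t *: y)) (fun z => z.1 + z.2));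
    last exact: add_continuous.
  apply: cvg_pair => /=; first exact: cvg_cst.
  apply: (@continuous_comp X (R^o * X)%type X (fun y => (t, y))
    (fun z => z.1 *: z.2)); last exact: scale_continuous.
  apply: (@cvg_pair _ _ _ _ (nbhs (t : R^o))); first exact: cvg_cst.
  exact: cvg_id.
apply/seteqP; split=> y /= [Ay Cy]; split=> //.
  have [] : (V `&` D) (x + t *: y); last by [].
  by rewrite -GV; split=> //; apply: CD; exists y.
have [] : (G `&` D) (x + t *: y); last by [].
by rewrite GV; split=> //; apply: CD; exists y.
Qed.

Lemma localization_preimage_affine V x t : convex_set V ->
  relatively_open CC V -> localization CC [set y | V (x + t *: y)].
Proof.
move=> cV oV; apply: localization_convex.
  exact: convex_set_preimage_affine.
exact: relatively_open_preimage_affine.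
Qed.

Lemma localizing_family_segment x :
  exists2 D, CC D & forall r : R, `|r| <= 1 -> D (r *: x).
Proof.
case: hCC => -[C CCC] hC hD.
(* [D] contains [0] and [- x], hence [E], which contains [x + 2 D], has both [x] and
   [x - 2 x = - x]; convexity gives the segment between them. *)
have [D CCD CD] := hD C (- x) 1 CCC; have [E CCE DE] := hD D x 2 CCD.
have [[_ C0] [_ D0] [cE _]] := And3 (hC C CCC) (hC D CCD) (hC E CCE).
exists E => // r r1; apply: (@convex_set_symm _ _ E 1) => //.
  by apply: DE; exists 0 => //; rewrite scaler0 addr0 scale1r.
apply: DE; exists (- x).
  by apply: CD; exists 0 => //; rewrite scaler0 addr0.
by rewrite scalerN scaleN1r scaler_nat mulr2n opprD addrA subrr add0r.
Qed.

(** On a member of [CC] containing the segment from [- x] to [x], [V] agrees with an open set [G],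
    and [r *: x] enters [G] for small [r] because scaling is continuous in the original topology. *)
Lemma relatively_open_absorbing V x : relatively_open CC V -> V 0 ->
  \forall r \near (0 : R^o), V (r *: x).
Proof.
have [D CCD Dx] := localizing_family_segment x.
move=> /(_ D CCD)[G oG GV] V0.
have D0 : D 0 by rewrite -(scale0r x); apply: Dx; rewrite normr0.
have G0 : G (0 *: x).
  by rewrite scale0r; have : (V `&` D) 0 by []; rewrite -GV => -[].
have cx : continuous (fun r : R^o => r *: x).
  move=> s.
  apply: (@continuous_comp R^o (R^o * X)%type X (fun r => (r, x))
    (fun z => z.1 *: z.2)); last exact: scale_continuous.
  apply: (@cvg_pair _ _ _ _ (nbhs (s : R^o))); first exact: cvg_id.
  exact: cvg_cst.
near=> r.
have [] : (V `&` D) (r *: x); last by [].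
rewrite -GV; split; last by apply: Dx; near: r; exact: (@nbhs0_le R R^o).
by near: r; apply: cx; exact: open_nbhs_nbhs.
Unshelve. all: by end_near. Qed.

Let S := localization_is_topology CC.

Lemma nbhs_localization (V : set X) (x : topologized S) :
  localization CC V -> V x -> nbhs x (V : set (topologized S)).
Proof. by move=> SV Vx; apply: open_nbhs_nbhs. Qed.

Lemma localization_nbhsE (x : topologized S) (U : set (topologized S)) :
  nbhs x U -> exists V : set X,
    [/\ convex_set V, V x, V `<=` U & relatively_open CC V].
Proof.
rewrite nbhsE => -[E [oE Ex] EU].
have [V [cV Vx VE oV]] := (oE : localization CC E) x Ex.
by exists V; split=> // y /VE /EU.
Qed.

Lemma localization_add_continuous :
  continuous (fun z : topologized S * topologized S => z.1 + z.2).
Proof.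
move=> [/= a b] U /localization_nbhsE[V [cV Vab VU oV]].
exists ([set y | V (b - a + 2 *: y)], [set y | V (a - b + 2 *: y)]).
  split; apply: nbhs_localization => /=;
      try exact: localization_preimage_affine.
    by rewrite scaler_nat mulr2n addrACA addNr addr0 addrC.
  by rewrite scaler_nat mulr2n addrACA addNr addr0.
move=> [y z] /= [Vy Vz]; apply: VU.
have /convex_setE := cV => /(_ _ _ 2^-1 Vy Vz ltac:(lra) ltac:(lra)).
have -> : 1 - 2^-1 = 2^-1 :> R by lra.
rewrite -scalerDr addrACA -[b - a]opprB addNr add0r -scalerDr scalerA.
by rewrite mulVf ?scale1r ?pnatr_eq0.
Qed.

Lemma localization_scale_continuous :
  continuous (fun z : R^o * topologized S => z.1 *: z.2).
Proof.
move=> [/= t x] U /localization_nbhsE[V [cV Vtx VU oV]].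
pose W : set X := [set y | V (t *: x + 1 *: y)].
have cW : convex_set W by exact: convex_set_preimage_affine.
have oW : relatively_open CC W by exact: relatively_open_preimage_affine.
have W0 : W 0 by rewrite /W /= scaler0 addr0.
(* Bounds [|s|] whenever [|s - t| <= 1], so that one neighbourhood of [x] serves all such [s]. *)
pose M := `|t| + 1.
have M0 : 0 < M by rewrite ltr_wpDl.
have WU y : W y -> U (t *: x + y) by move=> Wy; apply: VU; rewrite -[y]scale1r.
(* s y - t x = s (y - x) + (s - t) x, with |s| <= M *)
exists ([set s | `|s| <= M /\ W ((s - t) *: (2 *: x))],
  [set y | W (- ((2 * M) *: x) + (2 * M) *: y)] `&`
  [set y | W ((2 * M) *: x + - (2 * M) *: y)]).
  split => /=.
    have tr : (fun s : R^o => s - t) @ (t : R^o) --> (0 : R^o).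
      rewrite -[X in _ --> X](subrr t).
      by apply: cvgB; [exact: cvg_id|exact: cvg_cst].
    have near0 : \forall r \near (0 : R^o), `|r| <= 1 /\ W (r *: (2 *: x)).
      apply: filterI; first exact: (@nbhs0_le R R^o).
      exact: relatively_open_absorbing.
    apply: (@filterS _ _ (nbhs_filter (t : R^o)) _ _ _ (tr _ near0)).
    move=> s /= [st Ws]; split=> //.
    by rewrite -(subrKC t s) (le_trans (ler_normD _ _))// lerD2l.
  apply: filterI; apply: nbhs_localization => /=;
      try exact: localization_preimage_affine.
    by rewrite addNr.
  by rewrite scaleNr subrr.
move=> [s y] /= [[sM Ws] [Wy Wy']].
have -> : s *: y = t *: x + (s *: (y - x) + (s - t) *: x).
  by rewrite scalerBr scalerBl addrC addrA subrK subrK.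
(* The sum is the midpoint of the doubled summands. The second is in [W] by the choice of [s]; the
   first is [2 s (y - x)], which lies between the points [2 M (y - x)] and [- 2 M (y - x)] of
   [W]. *)
apply: WU; apply: convex_set_half => //; last by rewrite scalerA mulrC -scalerA.
rewrite scalerA; apply: (@convex_set_symm _ _ W (2 * M)) => //.
- by rewrite mulr_gt0.
- by rewrite normrM ger0_norm// ler_pM2l.
- by rewrite scalerBr addrC.
- by rewrite scalerBr addrC !scaleNr opprK -scaleNr; exact: Wy'.
Qed.

(** * Separation, existence and uniqueness *)

Hypothesis X_sep : forall x : X, closed [set x].

(** Open convex sets are good, so by local convexity the new topology refines the original one and
    inherits its closed points. *)
Lemma localization_closed1 (x : topologized S) : closed [set x].
Proof.
rewrite -[[set x]]setCK; apply: open_closedC.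
change (localization CC (~` [set (x : X)])) => y yx.
have oU : open (~` [set (x : X)]) by exact/closed_openC/X_sep.
have [V [cV oV Vy VU]] := open_convex_nbhs _ _ _ oU yx.
exists V; split=> //; exact: open_relatively_open.
Qed.

Lemma localization_lc_vector_topology :
  is_lc_vector_topology (localization CC).
Proof.
exists S; split.
- exact: localization_closed1.
- exact: localization_add_continuous.
- exact: localization_scale_continuous.
- exists [set V : set X | convex_set V /\ relatively_open CC V].
    by move=> V /set_mem[].
  split=> [V [cV oV]|x U /localization_nbhsE[V [cV Vx VU oV]]].
    exact: localization_convex.
  by exists V.
Qed.

Lemma localization_is_localization : is_localization CC (localization CC).
Proof.
split=> [|C CCC|Y f _]; first exact: localization_lc_vector_topology.
  exact: localization_trace.
exact: localization_preimage_open.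
Qed.

Lemma is_localization_unique T :
  is_localization CC T -> T = localization CC.
Proof.
move=> [lcT traceT univT]; have [hT [_ _ _ [B cB [oB bB]]]] := lcT.
apply/seteqP; split=> [E TE x Ex|].
  have [|V [BV Vx] VE] := bB x E; first exact: open_nbhs_nbhs.
  exists V; split=> //; first by apply: cB; exact: mem_set.
  by move=> C CCC; apply: traceT => //; exists V => //; exact: oB.
(* As [f] induces [localization CC], the trace condition for that topology makes [f] continuous on
   each member of [CC], and the universal property of [T] applies to [f]. *)
have [Y [f [Y_sep eqS]]] :=
  lc_vector_topology_tvs _ localization_lc_vector_topology.
rewrite eqS => _ [U oU <-]; apply: univT => // C CCC.
apply/within_continuous_trace => W oW.
have SW : localization CC (f @^-1` W) by rewrite eqS; exists W.
by apply: (localization_trace _ _ CCC); exists (f @^-1` W).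
Qed.

End LocalizingFamily.
End Localization.

Theorem theorem1p4 (R : realType) (X : tvsType R)
    (X_sep : forall x : X, closed [set x])
    (CC : set_system X) (hCC : localizing_family CC) :
  (exists! S : set_system X, is_localization CC S) /\
  (forall S : set_system X, is_localization CC S ->
     S = [set E : set X | forall x, E x ->
            exists V : set X, [/\ convex_set V, V x, V `<=` E &
              forall C, CC C -> trace open C (V `&` C)]]).
Proof.
have uniq := is_localization_unique _ _ _ hCC X_sep.
split; last exact: uniq.
exists (localization R X CC); split; first exact: localization_is_localization.
by move=> T /uniq.
Qed.
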